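(* Let $X$ be a set, let $S$ be a (nonempty) directed preorder and let $\vec{\mathcal I}=\langle \mathcal I_s : s\in S\rangle$ be a directed scheme of ideals on $X$, with $\mathcal I^*:=\bigcap_{s\in S}\mathcal I_s$. Then: (a) $\operatorname{minadd}(\vec{\mathcal I})\le \operatorname{add}(\mathcal I^* )$; (b) for every cofinal $D\subseteq S$, $\operatorname{supcov}(\vec{\mathcal I})\le \operatorname{cov}(\mathcal I^* )\le \mathfrak d\big(\prod_{s\in D}\mathrm{Cv}_{\mathcal I_s}\big)$; (c) $\operatorname{non}(\mathcal I^* )=\operatorname{minnon}(\vec{\mathcal I})$; (d) $$\operatorname{cof}(\mathcal I^* )\le \mathfrak d\Big(\prod\vec{\mathcal I}\Big)\le \operatorname{cov}\Big(\big([\operatorname{supcof}(\vec{\mathcal I})]^{<\operatorname{minadd}(\vec{\mathcal I})}\big)^{\operatorname{cof}(S)}\Big),$$ where $\prod\vec{\mathcal I}=\prod_{s\in S}\mathcal I_s$.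
   Context: A preorder $\langle S,\le\rangle$ (reflexive, transitive) is directed if any two elements have a common upper bound. $\operatorname{cof}(S)$ is the least size of a cofinal subset of $S$. Ideals on a set $X$ are proper ($X\notin\mathcal I$) and contain all singletons (hence all finite subsets) of $X$. A directed scheme of ideals on $X$ is a sequence $\vec{\mathcal I}=\langle\mathcal I_s : s\in S\rangle$ of ideals on $X$, indexed by a directed preorder $S$, such that $\mathcal I_{s'}\subseteq\mathcal I_s$ whenever $s\le s'$. For an ideal $\mathcal I$ on $X$: $\operatorname{add}(\mathcal I)$ is the least size of $\mathcal J\subseteq\mathcal I$ with $\bigcup\mathcal J\notin\mathcal I$; $\operatorname{cov}(\mathcal I)$ is the least size of $\mathcal J\subseteq\mathcal I$ with $\bigcup\mathcal J=X$; $\operatorname{non}(\mathcal I)$ is the least size of $A\subseteq X$ with $A\notin\mathcal I$; $\operatorname{cof}(\mathcal I)$ is the least size of a cofinal subset of $\langle\mathcal I,\subseteq\rangle$. For a scheme: $\operatorname{minadd}(\vec{\mathcal I})=\min_{s\in S}\operatorname{add}(\mathcal I_s)$, $\operatorname{minnon}(\vec{\mathcal I})=\min_{s\in S}\operatorname{non}(\mathcal I_s)$, $\operatorname{supcov}(\vec{\mathcal I})=\sup_{s\in S}\operatorname{cov}(\mathcal I_s)$, $\operatorname{supcof}(\vec{\mathcal I})=\sup_{s\in S}\operatorname{cof}(\mathcal I_s)$. A relational system is a triple $\mathbf R=\langle X,Y,\sqsubset\rangle$ with $X,Y$ nonempty and $\sqsubset$ a relation; $\mathfrak d(\mathbf R)$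 is the least size of $E\subseteq Y$ such that $\forall x\in X\,\exists y\in E\colon x\sqsubset y$. An ideal $\mathcal I$ on $X$ is regarded as the relational system $\langle\mathcal I,\mathcal I,\subseteq\rangle$, and $\mathrm{Cv}_{\mathcal I}:=\langle X,\mathcal I,\in\rangle$. For a sequence $\vec{\mathbf R}=\langle\mathbf R_i : i\in K\rangle$ of relational systems $\mathbf R_i=\langle X_i,Y_i,\sqsubset_i\rangle$, $\prod\vec{\mathbf R}=\prod_{i\in K}\mathbf R_i:=\langle\prod_{i\in K} X_i,\prod_{i\in K} Y_i,\sqsubset^\otimes\rangle$ where $x\sqsubset^\otimes y$ iff $x_i\sqsubset_i y_i$ for all $i\in K$. For cardinals $\mu\le\kappa$ and $\nu$, $\operatorname{cov}\big(([\kappa]^{<\mu})^{\nu}\big)$ is the least size of a family $F$ of functions $A\colon\nu\to[\kappa]^{<\mu}$ such that every $x\in{}^{\nu}\kappa$ satisfies, for some $A\in F$, $x(i)\in A(i)$ for all $i<\nu$.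
   Formalization: In (d) the second inequality fails as written (X=S=ℕ, all elements of S equivalent, every ideal the finite sets); it is proved for the product over any cofinal D⊆S with |D|=cof(S) (so for S itself if |S|=cof(S)), along with cof(I* )≤cov(…) for all S. *)

(* Defs.v *)
From mathcomp Require Import all_boot.
From mathcomp Require Import boolp classical_sets functions cardinality.

Set Implicit Arguments.
Unset Strict Implicit.
Unset Printing Implicit Defensive.

Local Open Scope classical_set_scope.
Local Open Scope card_scope.

(* A cardinal is an equipotence class of types, so that equality of cardinals
   is Leibniz equality; mathcomp-classical only compares individual sets, with
   [#<=] and [#=]. *)
Record cardinal : Type := Cardinal {
  equipotence_class : Type -> Prop;
  equipotence_classP : exists T : Type,
    equipotence_class = (fun U : Type => [set: U] #= [set: T]) }.

Definition card_of (T : Type) (A : set T) : cardinal :=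
  @Cardinal _ (ex_intro _ (set_type A) erefl).

(* A chosen type of cardinality [k]. *)
Definition card_repr (k : cardinal) : Type := sval (cid (equipotence_classP k)).

Definition cle (k l : cardinal) : Prop :=
  [set: card_repr k] #<= [set: card_repr l].

Definition clt (k l : cardinal) : Prop := cle k l /\ k <> l.

Declare Scope cardinal_scope.
Delimit Scope cardinal_scope with cardinal.
Bind Scope cardinal_scope with cardinal.
Notation "k <= l" := (cle k l) : cardinal_scope.
Notation "k < l" := (clt k l) : cardinal_scope.
Notation "k <= l <= m" := (cle k l /\ cle l m) : cardinal_scope.
Local Open Scope cardinal_scope.

Definition is_least (P : cardinal -> Prop) (k : cardinal) : Prop :=
  P k /\ forall l, P l -> k <= l.

(* Predicates on [cardinal] are bare functions: [set cardinal] would cause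
   universe inconsistencies.
   The least element exists as soon as [P] is nonempty (lemma
   [cmin_is_least] below); the value for empty [P] is a dummy. *)
Definition cmin (P : cardinal -> Prop) : cardinal :=
  if pselect (exists k, is_least P k) is left h then sval (cid h)
  else card_of (@set0 nat).

(* Only used for families indexed by a type, which are bounded above, so that
   the set of upper bounds is nonempty. *)
Definition csup (P : cardinal -> Prop) : cardinal :=
  cmin (fun k => forall l, P l -> l <= k).

Definition least_size (T : Type) (P : set (set T)) : cardinal :=
  cmin (fun k => exists2 A, P A & card_of A = k).

Lemma cardinal_ext (k l : cardinal) :
  equipotence_class k = equipotence_class l -> k = l.
Proof.
case: k l => C hC [D hD] /= e; subst D.
by congr Cardinal; exact: Prop_irrelevance.
Qed.

Lemma card_reprK (k : cardinal) : card_of [set: card_repr k] = k.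
Proof.
apply: cardinal_ext; rewrite /= /card_repr; case: (cid _) => T /= ->.
by apply/funext => U; rewrite (card_eqr (card_setT _)).
Qed.

Lemma eq_cardP (T U : Type) (A : set T) (B : set U) :
  card_of A = card_of B <-> A #= B.
Proof.
split=> [/(congr1 (fun k => equipotence_class k (set_type A))) /=|AB].
  by rewrite card_eqxx (card_eql (card_setT A)) (card_eqr (card_setT B)) => <-.
apply: cardinal_ext; apply/funext => V /=.
by rewrite (card_eqr (card_setT A)) (card_eqr (card_setT B)) (card_eqr AB).
Qed.

Lemma card_repr_card (T : Type) (A : set T) : [set: card_repr (card_of A)] #= A.
Proof. by apply/eq_cardP; rewrite card_reprK. Qed.

Lemma cle_card (T U : Type) (A : set T) (B : set U) :
  card_of A <= card_of B <-> A #<= B.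
Proof.
rewrite /cle (card_le_eql (card_repr_card A)).
by rewrite (card_le_eqr (card_repr_card B)).
Qed.

Lemma cle_refl (k : cardinal) : k <= k.
Proof. exact: card_lexx. Qed.

Lemma cle_trans (l k m : cardinal) : k <= l -> l <= m -> k <= m.
Proof. exact: card_le_trans. Qed.

Lemma cle_anti (k l : cardinal) : k <= l -> l <= k -> k = l.
Proof.
move=> kl lk; rewrite -(card_reprK k) -(card_reprK l); apply/eq_cardP.
exact/card_eqPle.
Qed.

Lemma inj_cardTP (T U : Type) :
  (exists f : T -> U, injective f) <-> [set: T] #<= [set: U].
Proof.
split=> [[f finj]|/card_leP[f]].
  by rewrite -(card_le_eql (inj_card_eq (in2W finj))); exact: card_leT.
pose g t := val (f (exist _ t (mem_set I))).
exists g => t t' /val_inj e.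
by have /(congr1 val) := 'inj_f (in_setT _) (in_setT _) e.
Qed.

Lemma fam_has_least (I : Type) (T : I -> Type) (i0 : I) :
  exists i, forall j, [set: T i] #<= [set: T j].
Proof.
pose Q := [set F : set (forall i, T i) |
  forall f g i, F f -> F g -> f i = g i -> f = g].
have [F [QF Fmax]] : exists F, Q F /\ forall G, F `<` G -> ~ Q G.
  apply: Zorn_bigcup => C CQ Ctot f g i [A CA Af] [B CB Bg].
  by have [AB|BA] := Ctot _ _ CA CB;
    [apply: (CQ B) => //; exact: AB|apply: (CQ A) => //; exact: BA].
have [i Fi] : exists i, forall t, exists2 f, F f & f i = t.
  apply: contrapT => noF.
  have hex i : {t : T i | forall f, F f -> f i <> t}.
    apply: cid; apply: contrapT => nt; apply: noF; exists i => t.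
    apply: contrapT => nf; apply: nt; exists t => f Ff fi.
    by apply: nf; exists f.
  pose h i := sval (hex i).
  have hF i f : F f -> f i <> h i by exact: (svalP (hex i)).
  have nFh : ~ F h by move=> Fh; exact: (hF i0 h Fh).
  apply: (Fmax (F `|` [set h])).
    by split=> [f Ff|sub]; [left|apply: nFh; apply: sub; right].
  move=> f g i [Ff|->] [Fg|->] //; first exact: QF.
    by move=> e; case: (hF i f Ff).
  by move=> /esym e; case: (hF i g Fg).
exists i => j; apply/inj_cardTP.
pose u t := s2val (cid2 (Fi t)).
have uP t : F (u t) /\ u t i = t by rewrite /u; case: (cid2 _).
exists (fun t => u t j) => t t' e; have [[Ft <-] [Ft' <-]] := (uP t, uP t').
by rewrite (QF _ _ _ Ft Ft' e).
Qed.

Lemma cle_total (k l : cardinal) : k <= l \/ l <= k.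
Proof.
have [[] h] := fam_has_least
  (fun b : bool => if b then card_repr k else card_repr l) true.
  by left; exact: (h false).
by right; exact: (h true).
Qed.

Lemma cmin_is_least (P : cardinal -> Prop) :
  (exists k, P k) -> is_least P (cmin P).
Proof.
move=> [k0 Pk0]; suff h : exists k, is_least P k.
  by rewrite /cmin; case: pselect => // h'; exact: (svalP (cid h')).
pose J := {A : set (card_repr k0) | P (card_of A)}.
have PT : P (card_of [set: card_repr k0]) by rewrite card_reprK.
have [[A PA] Amin] :=
  fam_has_least (fun A : J => set_type (sval A)) (exist _ _ PT : J).
exists (card_of A); split=> // l Pl.
have [lk|kl] := cle_total l k0; last first.
  apply: cle_trans kl; rewrite -[k in _ <= k](card_reprK k0); apply/cle_card.
  exact: card_leT.
have [f finj] := (inj_cardTP _ _).2 lk.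
have e : card_of (range f) = l.
  rewrite -[RHS](card_reprK l); apply/eq_cardP.
  exact: (inj_card_eq (in2W finj)).
have PB : P (card_of (range f)) by rewrite e.
have := Amin (exist _ _ PB); rewrite (card_le_eql (card_setT A)).
by rewrite (card_le_eqr (card_setT (range f))) => /cle_card; rewrite e.
Qed.

Record relsys : Type := RelSys {
  challenge : Type;
  response : Type;
  related : challenge -> response -> Prop;
  challenge_inhabited : inhabited challenge;
  response_inhabited : inhabited response }.

Definition dnum (R : relsys) : cardinal :=
  least_size [set E : set (response R) |
    forall x : challenge R, exists2 y, E y & related x y].

Lemma inhabited_prod (K : Type) (T : K -> Type) :
  (forall i, inhabited (T i)) -> inhabited (forall i, T i).
Proof. by move=> h; constructor=> i; exact: inhabited_witness. Qed.

Definition prod_relsys (K : Type) (R : K -> relsys) : relsys := {|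
  challenge := forall i, challenge (R i);
  response := forall i, response (R i);
  related := fun x y => forall i, related (x i) (y i);
  challenge_inhabited := inhabited_prod (fun i => challenge_inhabited (R i));
  response_inhabited := inhabited_prod (fun i => response_inhabited (R i)) |}.

Record directed_preorder (S : Type) (le : S -> S -> Prop) : Prop := {
  directed_inhabited : inhabited S;
  directed_refl : forall s, le s s;
  directed_trans : forall t s u, le s t -> le t u -> le s u;
  directed_ub : forall s t, exists u, le s u /\ le t u }.

Definition cofinal (S : Type) (le : S -> S -> Prop) (D : set S) : Prop :=
  forall s, exists2 d, D d & le s d.

Definition cofinality (S : Type) (le : S -> S -> Prop) : cardinal :=
  least_size (cofinal le).

Record ideal (X : Type) : Type := Ideal {
  ideal_set :> set (set X);
  ideal0 : ideal_set set0;
  ideal1 : forall x, ideal_set [set x];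
  idealU : forall A B, ideal_set A -> ideal_set B -> ideal_set (A `|` B);
  idealS : forall A B, A `<=` B -> ideal_set B -> ideal_set A;
  ideal_proper : ~ ideal_set [set: X] }.

Section Invariants.
Variables (X : Type) (I : set (set X)).

Definition add : cardinal :=
  least_size [set J : set (set X) | J `<=` I /\ ~ I (\bigcup_(A in J) A)].

Definition cov : cardinal :=
  least_size [set J : set (set X) | J `<=` I /\ \bigcup_(A in J) A = [set: X]].

Definition non : cardinal := least_size [set A : set X | ~ I A].

Definition cof : cardinal :=
  cofinality (fun A B : set_type I => val A `<=` val B).

End Invariants.

Lemma ideal_inhabited (X : Type) (I : ideal X) : inhabited (set_type I).
Proof. by constructor; exact: (exist _ set0 (mem_set (ideal0 I))). Qed.

Lemma ideal_carrier_inhabited (X : Type) (I : ideal X) : inhabited X.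
Proof.
apply: contrapT => nX; apply: (@ideal_proper _ I).
apply: idealS (ideal0 I) => x _.
by case: nX.
Qed.

Definition ideal_relsys (X : Type) (I : ideal X) : relsys := {|
  challenge := set_type I;
  response := set_type I;
  related := fun A B => val A `<=` val B;
  challenge_inhabited := ideal_inhabited I;
  response_inhabited := ideal_inhabited I |}.

Definition Cv (X : Type) (I : ideal X) : relsys := {|
  challenge := X;
  response := set_type I;
  related := fun x A => val A x;
  challenge_inhabited := ideal_carrier_inhabited I;
  response_inhabited := ideal_inhabited I |}.

Definition directed_scheme (X S : Type) (le : S -> S -> Prop)
    (I : S -> ideal X) : Prop :=
  directed_preorder le /\ forall s s', le s s' -> I s' `<=` I s.

Section SchemeInvariants.
Variables (X S : Type) (I : S -> ideal X).

Definition minadd : cardinal := cmin (fun k => exists s, add (I s) = k).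
Definition minnon : cardinal := cmin (fun k => exists s, non (I s) = k).
Definition supcov : cardinal := csup (fun k => exists s, cov (I s) = k).
Definition supcof : cardinal := csup (fun k => exists s, cof (I s) = k).

Definition scheme_cap : set (set X) := \bigcap_s (I s : set (set X)).

End SchemeInvariants.

(* The set of subsets of [k] of size less than [m]. *)
Definition subsets_lt (k m : cardinal) : set (set (card_repr k)) :=
  [set A | card_of A < m].
Arguments subsets_lt : clear implicits.

(* The least number of [m]-slaloms, i.e. maps [n -> [k]^{<m}], needed to
   localize every map [n -> k]. *)
Definition slalom_cov (k m n : cardinal) : cardinal :=
  least_size [set F : set (card_repr n -> set_type (subsets_lt k m)) |
    forall x : card_repr n -> card_repr k,
      exists2 A, F A & forall i, val (A i) (x i)].

(* Main.v *)
Require Import Defs.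
From mathcomp Require Import all_boot.
From mathcomp Require Import boolp classical_sets functions cardinality.

(** Every inequality between the invariants comes from turning a witness for
    the larger one into a witness for the smaller one.

    Parts (a), (c) and the lower bound in (b) only use that a set lies in the
    intersection [Istar] exactly when it lies in every [I s]: a family inside
    [Istar] with union outside it already escapes some [I s], and a family
    inside [Istar] that covers [X] lies inside every [I s].

    The other bounds compare dominating numbers, and are Tukey connections
    (lemma [dominating_tukey]).  The upper bound in (b) and the bounds on
    [cof Istar] by products in (d) share one connection.  If [f : K -> S] is
    cofinal and [y k] is in [I (f k)] for all [k], the intersection of the
    [y k] is in [Istar]: every [s] is below some [f k], and [y k] is in
    [I (f k)], which is included in [I s] (lemma [cap_transversal]).  So
    responses in the product are intersected into responses for [Istar], while
    a challenge for [Istar] becomes a constant sequence.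

    The slalom bound is proved one coordinate at a time (lemma
    [ideal_tukey_slalom]): a cofinal subset of [I s] of size [cof (I s)] injects
    into [supcof I], so a member of [I s] can be coded by an element of
    [supcof I] naming a larger set from this subset.  Fewer than [minadd I]
    codes name sets whose union is still in [I s], and this union includes every
    set whose code is among them.  Doing this for all [s] in [D] turns a slalom
    capturing the sequence of codes into a response in the product (lemma
    [slalom_bound]).  Some family of slaloms must localize every function, for
    otherwise the number of slaloms would be a minimum over no family at all;
    singletons provide one because [1 < minadd I] (lemmas [card1_lt_add] and
    [slalom_total]). *)

Set Implicit Arguments.
Unset Strict Implicit.
Unset Printing Implicit Defensive.

Local Open Scope classical_set_scope.
Local Open Scope cardinal_scope.

(** * Least cardinals *)

Lemma not_cle_clt (k l : cardinal) : ~ k <= l -> l < k.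
Proof.
move=> nkl; split; first by case: (cle_total k l).
by move=> lk; apply: nkl; rewrite lk; exact: cle_refl.
Qed.

Lemma clt_not_cle (k l : cardinal) : k < l -> ~ l <= k.
Proof. by move=> [kl neq] lk; apply: neq; exact: cle_anti. Qed.

Lemma cmin_le (P : cardinal -> Prop) (k : cardinal) : P k -> cmin P <= k.
Proof. by move=> Pk; apply: (cmin_is_least (ex_intro P k Pk)).2. Qed.

Lemma cmin_attained (P : cardinal -> Prop) (k : cardinal) : P k -> P (cmin P).
Proof. by move=> Pk; apply: (cmin_is_least (ex_intro P k Pk)).1. Qed.

Lemma csup_le (P : cardinal -> Prop) (k : cardinal) :
  (forall l, P l -> l <= k) -> csup P <= k.
Proof. exact: cmin_le. Qed.

Lemma le_csup (P : cardinal -> Prop) (b l : cardinal) :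
  (forall k, P k -> k <= b) -> P l -> l <= csup P.
Proof.
move=> Pb.
have := @cmin_attained (fun k => forall l, P l -> l <= k) b Pb.
exact.
Qed.

Lemma least_size_le (T : Type) (P : set (set T)) (A : set T) :
  P A -> least_size P <= card_of A.
Proof. by move=> PA; apply: cmin_le; exists A. Qed.

Lemma least_size_attained (T : Type) (P : set (set T)) (A : set T) :
  P A -> exists2 B, P B & card_of B = least_size P.
Proof.
move=> PA.
have := @cmin_attained (fun k => exists2 B, P B & card_of B = k) (card_of A).
by apply; exists A.
Qed.

Lemma least_size_sub (T : Type) (P Q : set (set T)) (A : set T) :
  P A -> P `<=` Q -> least_size Q <= least_size P.
Proof.
by move=> /least_size_attained[B PB <-] PQ; exact: least_size_le (PQ _ PB).
Qed.

Lemma card_of_image (T U : Type) (f : T -> U) (A : set T) :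
  card_of (f @` A) <= card_of A.
Proof. by apply/cle_card; exact: card_image_le. Qed.

(** * Dominating families and Tukey connections *)

(** Stated for bare relations, so that cofinal sets, dominating families of
    relational systems and localizing families of slaloms are all instances
    by conversion. *)
Definition dominating (A B : Type) (r : A -> B -> Prop) : set (set B) :=
  [set E | forall x, exists2 y, E y & r x y].

Lemma dominating_setT (A B : Type) (r : A -> B -> Prop) :
  (forall x, exists y, r x y) -> dominating r [set: B].
Proof. by move=> tot x; have [y rxy] := tot x; exists y. Qed.

(** Totality of [r'] guarantees that its dominating number is attained. *)
Lemma dominating_tukey (A B A' B' : Type)
    (r : A -> B -> Prop) (r' : A' -> B' -> Prop) (f : A -> A') (g : B' -> B) :
  (forall x', exists y', r' x' y') ->
  (forall x y', r' (f x) y' -> r x (g y')) ->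
  least_size (dominating r) <= least_size (dominating r').
Proof.
move=> /dominating_setT/least_size_attained[E domE <-] fg.
apply: cle_trans (card_of_image g E); apply: least_size_le => x.
have [y Ey rxy] := domE (f x).
by exists (g y); [exists y|exact: fg].
Qed.

(** * Invariants of a single ideal *)

Section Ideal.
Variables (X : Type) (I : ideal X).

Lemma ideal_bigcup (J : set (set X)) :
  J `<=` I -> card_of J < add I -> ideal_set I (\bigcup_(B in J) B).
Proof.
move=> JI /clt_not_cle nle; apply: contrapT => nI; apply: nle.
exact: least_size_le.
Qed.

Lemma ideal_all_cover : \bigcup_(A in I) A = [set: X].
Proof.
by apply/seteqP; split=> // x _; exists [set x]; first exact: ideal1.
Qed.

Lemma add_attained : exists2 J : set (set X),
  J `<=` I /\ ~ ideal_set I (\bigcup_(A in J) A) & card_of J = add I.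
Proof.
apply: (@least_size_attained _ _ (I : set (set X))); split=> //.
by rewrite ideal_all_cover; exact: ideal_proper.
Qed.

Lemma non_attained : exists2 A : set X, ~ ideal_set I A & card_of A = non I.
Proof. by apply: (@least_size_attained _ _ setT); exact: ideal_proper. Qed.

(** A family with at most one member has an empty union or that member as its
    union, and both are in the ideal. *)
Lemma card1_lt_add (T : Type) (t : T) : card_of [set t] < add I.
Proof.
apply: not_cle_clt => le1; have [J [JI nIJ] cJ] := add_attained.
move: le1; rewrite -cJ => /(cle_card J [set t]).1/card_leP[h].
have J1 A B : J A -> J B -> A = B.
  move=> JA JB.
  pose a : J := SigSub (mem_set JA); pose b : J := SigSub (mem_set JB).
  have /('inj_h (in_setT _) (in_setT _)) /(congr1 val) // : h a = h b.
  by apply: val_inj; rewrite (set_valP (h a)) (set_valP (h b)).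
apply: nIJ; have [[A JA]|J0] := pselect (exists A, J A).
  by apply: idealS (JI _ JA) => x [B JB Bx]; rewrite (J1 A B).
by apply: idealS (ideal0 I) => x [B JB _]; apply: J0; exists B.
Qed.

Lemma cof_attained : exists2 C : set (set_type I),
  dominating (fun A B : set_type I => val A `<=` val B) C & card_of C = cof I.
Proof.
apply: (@least_size_attained _ _ setT); apply: dominating_setT => A.
by exists A.
Qed.

Lemma cof_le_powerset : cof I <= card_of [set: set X].
Proof.
have : dominating (fun A B : set_type I => val A `<=` val B) setT.
  by apply: dominating_setT => A; exists A.
move=> /least_size_le le; apply: cle_trans le _; apply/cle_card/inj_cardTP.
by exists val; exact: val_inj.
Qed.

Lemma cov_le_dnum_Cv : cov I <= dnum (Cv I).
Proof.
have tot : forall x : X, exists A : set_type I, val A x.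
  by move=> x; exists (SigSub (mem_set (ideal1 I x))).
have [E domE cE] := least_size_attained (dominating_setT tot).
rewrite (_ : dnum _ = card_of E) //.
apply: cle_trans (card_of_image val E); apply: least_size_le; split.
  by move=> _ [A _ <-]; exact: set_valP.
apply/seteqP; split=> // x _; have [A EA Ax] := domE x.
by exists (val A) => //; exists A.
Qed.

End Ideal.

(** * Directed schemes *)

Section Scheme.
Variables (X S : Type) (le : S -> S -> Prop) (I : S -> ideal X).
Hypothesis hI : directed_scheme le I.

Let s0 : S := inhabited_witness (directed_inhabited hI.1).

Lemma scheme_cap_proper : ~ scheme_cap I [set: X].
Proof. by move=> /(_ s0 Logic.I); exact: ideal_proper. Qed.

Definition cap_ideal : ideal X := {|
  ideal_set := scheme_cap I;
  ideal0 := fun s _ => ideal0 (I s);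
  ideal1 := fun x s _ => ideal1 (I s) x;
  idealU := fun A B IA IB s _ => idealU (IA s Logic.I) (IB s Logic.I);
  idealS := fun A B AB IB s _ => idealS AB (IB s Logic.I);
  ideal_proper := scheme_cap_proper |}.

Lemma not_scheme_cap (A : set X) :
  ~ scheme_cap I A -> exists s, ~ ideal_set (I s) A.
Proof.
by move=> nA; apply: contrapT => nex; apply: nA => s _; apply: contrapT => nIs;
  apply: nex; exists s.
Qed.

Lemma minadd_attained : exists s, add (I s) = minadd I.
Proof.
by apply: (@cmin_attained (fun k => exists s, add (I s) = k) (add (I s0)));
  exists s0.
Qed.

Lemma minadd_le (s : S) : minadd I <= add (I s).
Proof. by apply: cmin_le; exists s. Qed.

Lemma minadd_le_add : minadd I <= add (scheme_cap I).
Proof.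
have [J [JI nIJ] <-] := add_attained cap_ideal.
have [s nIsJ] := not_scheme_cap nIJ.
apply: cle_trans (minadd_le s) _; apply: least_size_le; split=> // A /JI.
exact.
Qed.

Lemma supcov_le_cov : supcov I <= cov (scheme_cap I).
Proof.
apply: csup_le => _ [s <-].
apply: (@least_size_sub _ _ _ (scheme_cap I)).
  by split=> //; exact: (ideal_all_cover cap_ideal).
by move=> J [JI covJ]; split=> // A /JI; exact.
Qed.

Lemma non_scheme_cap : non (scheme_cap I) = minnon I.
Proof.
apply: cle_anti.
  have [s <-] : exists s, non (I s) = minnon I.
    by apply: (@cmin_attained (fun k => exists s, non (I s) = k) (non (I s0)));
      exists s0.
  by apply: least_size_sub (@ideal_proper _ (I s)) _ => A nIA /(_ s Logic.I).
have [A nA <-] := non_attained cap_ideal.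
have [s nIsA] := not_scheme_cap nA.
apply: (@cle_trans (non (I s))); first by apply: cmin_le; exists s.
exact: least_size_le.
Qed.

(** * Products along a cofinal family of indices *)

Section Cofinal.
Variables (K : Type) (f : K -> S).
Hypothesis f_cofinal : forall s, exists k, le s (f k).

(** For [s] below [f k], the intersection is included in [y k], which is in
    [I (f k)] and hence in [I s]. *)
Lemma cap_transversal (y : forall k, set_type (I (f k))) :
  ideal_set cap_ideal (\bigcap_k val (y k)).
Proof.
move=> s _; have [k lek] := f_cofinal s.
apply: hI.2 lek _ _; apply: idealS (set_valP (y k)) => x.
exact.
Qed.

Definition transversal_cap (y : forall k, set_type (I (f k))) :
    set_type cap_ideal :=
  SigSub (mem_set (cap_transversal y)).

Lemma cov_le_dnum_prod_Cv :
  cov (scheme_cap I) <= dnum (prod_relsys (fun k => Cv (I (f k)))).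
Proof.
apply: cle_trans (cov_le_dnum_Cv cap_ideal) _.
pose r' := @related (prod_relsys (fun k => Cv (I (f k)))).
apply: (@dominating_tukey _ _ _ _ (@related (Cv cap_ideal)) r'
  (fun x _ => x) transversal_cap).
  by move=> x; exists (fun k => SigSub (mem_set (ideal1 (I (f k)) (x k)))).
by move=> x y xy k _; exact: xy.
Qed.

Lemma cof_le_dnum_prod :
  cof (scheme_cap I) <= dnum (prod_relsys (fun k => ideal_relsys (I (f k)))).
Proof.
pose r' := @related (prod_relsys (fun k => ideal_relsys (I (f k)))).
apply: (@dominating_tukey _ _ _ _ (@related (ideal_relsys cap_ideal)) r'
  (fun A k => SigSub (mem_set (set_valP A (f k) Logic.I)))
  transversal_cap).
  by move=> x; exists x => k.
by move=> A y Ay x Ax k _; exact: Ay.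
Qed.

End Cofinal.

(** * Slaloms *)

Lemma cof_le_supcof (s : S) : cof (I s) <= supcof I.
Proof.
apply: (@le_csup _ (card_of [set: set X])); last by exists s.
by move=> _ [t <-]; exact: cof_le_powerset.
Qed.

(** Slaloms of singletons suffice, since [1 < minadd I]. *)
Lemma slalom_total (N : Type) (x : N -> card_repr (supcof I)) :
  exists A : N -> set_type (subsets_lt (supcof I) (minadd I)),
    forall i, val (A i) (x i).
Proof.
have lt1 i : subsets_lt (supcof I) (minadd I) [set x i].
  by have [s <-] := minadd_attained; exact: card1_lt_add.
by exists (fun i => SigSub (mem_set (lt1 i))).
Qed.

(** A cofinal [C] in [I s] of size [cof (I s)] is labelled injectively by
    elements of [supcof I].  A set is sent to the label of a member of [C]
    including it, and a set of fewer than [minadd I] labels to the union of the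
    members of [C] carrying them, which stays in [I s] because
    [minadd I <= add (I s)].  The two maps are packed in a pair so that they
    can be chosen for all [s] at once. *)
Lemma ideal_tukey_slalom (s : S) :
  exists p : (set_type (I s) -> card_repr (supcof I)) *
             (set_type (subsets_lt (supcof I) (minadd I)) -> set_type (I s)),
    forall x A, val A (p.1 x) -> val x `<=` val (p.2 A).
Proof.
have [C domC cC] := cof_attained (I s).
have [e einj] : exists e : C -> card_repr (supcof I), injective e.
  apply/inj_cardTP; rewrite (card_le_eql (card_setT C)); apply/cle_card.
  by rewrite card_reprK cC; exact: cof_le_supcof.
have domC' (x : set_type (I s)) : exists B : C, val x `<=` val (val B).
  by have [B CB xB] := domC x; exists (SigSub (mem_set CB)).
have [c cP] := choice domC'.
pose labelled (A : set_type (subsets_lt (supcof I) (minadd I))) : set C :=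
  [set B | val A (e B)].
have labelledI A : ideal_set (I s) (\bigcup_(B in labelled A) val (val B)).
  rewrite -(bigcup_image (labelled A) (fun B => val (val B)) id).
  apply: ideal_bigcup; first by move=> _ [B _ <-]; exact: set_valP.
  apply: not_cle_clt => addle; have := set_valP A => /clt_not_cle; apply.
  apply: cle_trans (minadd_le s) _; apply: cle_trans addle _.
  apply: cle_trans (card_of_image _ _) _.
  have <- : card_of (e @` labelled A) = card_of (labelled A).
    by apply/eq_cardP/inj_card_eq => B B' _ _; exact: einj.
  by apply/cle_card/subset_card_le => _ [B AB <-].
exists (e \o c, fun A => SigSub (mem_set (labelledI A))) => x A /= Ae y xy.
by exists (c x) => //; exact: cP.
Qed.

Lemma slalom_bound (D : set S) (n : cardinal) : card_of D = n ->
  dnum (prod_relsys (fun s : D => ideal_relsys (I (val s))))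
    <= slalom_cov (supcof I) (minadd I) n.
Proof.
move=> cD.
(* [h] and [g] transport sequences between [D] and the type of size [n] that
   indexes slaloms. *)
have [h [g gK]] : exists (h : card_repr n -> D) (g : D -> card_repr n),
    cancel g h.
  have /card_bijP[h [g _ gK]] : ([set: card_repr n] #= D)%card.
    by apply/eq_cardP; rewrite card_reprK.
  exists (h \o to_setT), (val \o g) => s /=.
  by rewrite -[RHS]gK; congr h; exact: val_inj.
pose p s := sval (cid (ideal_tukey_slalom s)).
have pP s := svalP (cid (ideal_tukey_slalom s)).
apply: (@dominating_tukey _ _ _ _
  (@related (prod_relsys (fun s : D => ideal_relsys (I (val s))))) _
  (fun x i => (p (val (h i))).1 (x (h i)))
  (fun A s => (p (val s)).2 (A (g s)))).
  exact: slalom_total.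
move=> x A Ax s; apply: pP.
by have := Ax (g s); rewrite gK.
Qed.

End Scheme.

(** * The invariants of the intersection *)

Theorem theoremA (X S : Type) (le : S -> S -> Prop) (I : S -> ideal X)
    (hI : directed_scheme le I) :
  let Istar := scheme_cap I in
  [/\ minadd I <= add Istar,
      forall D : set S, cofinal le D ->
        supcov I <= cov Istar
          <= dnum (prod_relsys (fun s : D => Cv (I (val s)))),
      non Istar = minnon I
    & [/\ cof Istar <= dnum (prod_relsys (fun s : S => ideal_relsys (I s))),
          forall D : set S, cofinal le D -> card_of D = cofinality le ->
            cof Istar
              <= dnum (prod_relsys (fun s : D => ideal_relsys (I (val s))))
              <= slalom_cov (supcof I) (minadd I) (cofinality le)
        & cof Istar <= slalom_cov (supcof I) (minadd I) (cofinality le)]].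
Proof.
move=> Istar.
have valP (D : set S) : cofinal le D -> forall s, exists d : D, le s (val d).
  by move=> cofD s; have [d Dd sd] := cofD s; exists (SigSub (mem_set Dd)).
have bound (D : set S) : cofinal le D -> card_of D = cofinality le ->
    cof Istar <= dnum (prod_relsys (fun s : D => ideal_relsys (I (val s))))
      <= slalom_cov (supcof I) (minadd I) (cofinality le).
  move=> cofD cD; split; last exact (slalom_bound hI cD).
  exact (cof_le_dnum_prod hI (valP D cofD)).
split.
- exact: minadd_le_add hI.
- move=> D cofD; split; first exact: supcov_le_cov hI.
  exact (cov_le_dnum_prod_Cv hI (valP D cofD)).
- exact: non_scheme_cap hI.
- split=> //.
    have refl s : exists t, le s (id t).
      by exists s; exact: directed_refl hI.1 s.
    exact (cof_le_dnum_prod hI refl).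
  have cofT : cofinal le [set: S].
    by move=> s; exists s => //; exact: directed_refl hI.1 s.
  have [D cofD cD] := least_size_attained cofT.
  by have [cof_le le_slalom] := bound D cofD cD; exact: cle_trans le_slalom.
Qed.
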